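(* Let $p\ge1$ and $T\in\mathbb{N}$. The equispaced configuration $\mathbf{X}^{\mathrm{eq}}=\mathbb{Z}$ is, up to translations, the unique minimiser of $\mathcal{F}^0_p$ in $\mathbb{X}_T$.
   Context: One-dimensional setting. Let $T\in\mathbb{N}$. A configuration is a set $\mathbf{X}=\bigcup_{k\in\mathbb{Z}}(\bar{\mathbf{X}}+kT)$ with $\bar{\mathbf{X}}=(x_1,\dots,x_T)\in[0,T)^T$, $x_i\le x_j$ for $i<j$ (points counted with multiplicity); $\mathbb{X}_T$ is the set of configurations. Translations: $\mathbf{X}+a=\{x+a:x\in\mathbf{X}\}$. For $\mathbf{X}\in\mathbb{X}_T$, $u[\mathbf{X}]$ is the $T$-periodic function (defined up to an additive constant) with distributional derivative $\mathrm{D}u[\mathbf{X}]=\mathcal{L}^1-\sum_{x\in\mathbf{X}}\delta_x$ (multiplicities counted). $\mathcal{F}^0_p[\mathbf{X}]=\int_0^T\int_0^T|u[\mathbf{X}](x)-u[\mathbf{X}](y)|^p\,\mathrm{d}y\,\mathrm{d}x$. *)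

(* Defs.v *)
From HB Require Import structures.
From mathcomp Require Import all_boot all_order all_algebra.
From mathcomp Require Import all_classical all_reals all_analysis.
Set Implicit Arguments. Unset Strict Implicit. Unset Printing Implicit Defensive.
Import Order.TTheory GRing.Theory Num.Theory.
Local Open Scope ring_scope.
Local Open Scope classical_set_scope.

(* A configuration in X_T is represented by its fundamental tuple
   xb = (x_1,...,x_T), indices 'I_T, with 0 <= x_i < T and x_i <= x_j for i <= j.
   The configuration itself is X = \bigcup_k (xb + kT), with multiplicities. *)
Definition is_config (R : realType) (T : nat) (xb : 'I_T -> R) : Prop :=
  (forall i, 0 <= xb i < T%:R) /\
  (forall i j : 'I_T, (i <= j)%N -> xb i <= xb j).

Definition mult (R : realType) (T : nat) (xb : 'I_T -> R) (y : R) : nat :=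
  \sum_(i < T) (nat_of_bool `[< exists k : int, (y = xb i + k%:~R * T%:R)%R >]).

Definition eq_config (R : realType) (T : nat) : 'I_T -> R := fun i => (i : nat)%:R.

(* u[X]: the T-periodic (right-continuous) function with Du = L^1 - sum_{x in X} delta_x,
   normalised by u(x) = x - #{i : x_i <= x} on [0,T); explicitly
   u(x) = x - sum_i (floor((x - x_i)/T) + 1), counting the points x_i + kT in [0,x]
   for x >= 0. *)
Definition u (R : realType) (T : nat) (xb : 'I_T -> R) (x : R) : R :=
  x - \sum_(i < T) ((Num.floor ((x - xb i) / T%:R))%:~R + 1).

Definition F0 (R : realType) (p : R) (T : nat) (xb : 'I_T -> R) : \bar R :=
  (\int[lebesgue_measure]_(x in `[0%R, T%:R]%classic)
     \int[lebesgue_measure]_(y in `[0%R, T%:R]%classic)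
        ((`|u xb x - u xb y| `^ p)%:E))%E.
Arguments eq_config : clear implicits.

(* Main.v *)
Require Import Defs.
From HB Require Import structures.
From mathcomp Require Import all_boot all_order all_algebra.
From mathcomp Require Import all_classical all_reals all_analysis.
From mathcomp Require Import measurable_realfun.
From mathcomp Require Import ring lra zify.
Import Order.TTheory GRing.Theory Num.Theory.
Local Open Scope ring_scope.
Set Implicit Arguments. Unset Strict Implicit. Unset Printing Implicit Defensive.

(** Write d = u(x) - u(y) and s = x - y, so that s - d is an integer. Among the
    admissible values s - Z of d, exactly two consecutive ones lie in ]-1, 1[ (only
    0 if s is an integer), and by convexity |d|^p lies above the affine function of
    d that agrees with it there (the zero function if s is an integer), strictly so
    when |d| >= 1. The slope of this affine function is odd and 1-periodic in s,
    hence its mean over a period vanishes and the integral of the affine bound over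
    [0,T]^2 does not depend on X.
    So F^0_p is at least that integral, with equality when u oscillates by less than
    1 (as it does for translates of Z) and strict inequality when it oscillates by
    more than 1. Finally, since u jumps down by at least 1 at each point of X and
    grows at unit speed elsewhere, oscillation at most 1 forces u to take its minimum
    at every point of X, and X is then an arithmetic progression of step 1. *)

(** * The affine lower bound for the p-th power *)

Definition fpart (R : realType) (s : R) : R := s - (Num.floor s)%:~R.

(* The opposite of the slope of the affine bound. At an integer [s] both fractional
   parts vanish, so the value is 0 and [slope p] is odd on the whole line. *)
Definition slope (R : realType) (p s : R) : R := fpart (- s) `^ p - fpart s `^ p.

(* The affine function of [d] with value [fpart s `^ p] at [fpart s] and, for
   non-integral [s], value [(1 - fpart s) `^ p] at [fpart s - 1]. *)
Definition chord (R : realType) (p s d : R) : R :=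
  fpart s `^ p + (fpart s - d) * slope p s.

Section Chord.
Variables (R : realType).
Implicit Types (p s d t q x : R).

Lemma fpart_itv s : 0 <= fpart s < 1.
Proof.
by rewrite subr_ge0 floor_le /= ltrBlDl -[1]/(1%:~R) -intrD floorD1_gt.
Qed.

Lemma fpartDz s (k : int) : fpart (s + k%:~R) = fpart s.
Proof.
by rewrite /fpart floorDrz ?intr_int // intrKfloor intrD; ring.
Qed.

Lemma fpartN s : fpart (- s) = if fpart s == 0 then 0 else 1 - fpart s.
Proof.
have /andP[f0 f1] := fpart_itv s.
have {1}-> : - s = - fpart s + (- Num.floor s)%:~R.
  by rewrite /fpart rmorphN /=; ring.
rewrite fpartDz; case: eqVneq => [->|fn0].
  by rewrite /fpart oppr0 floor0 subrr.
have {fn0}f0 : 0 < fpart s by rewrite lt_def fn0.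
rewrite {1}/fpart (_ : Num.floor (- fpart s) = (-1)); first by rewrite opprK addrC.
by apply: floor_def; rewrite addNr rmorphN /=; lra.
Qed.

Lemma slopeN p s : slope p (- s) = - slope p s.
Proof. by rewrite /slope opprK opprB. Qed.

Lemma slopeDz p s (k : int) : slope p (s + k%:~R) = slope p s.
Proof. by rewrite /slope opprD -rmorphN /= !fpartDz. Qed.

(** Follows from the oddness of the slope; for non-integral [s] the two contact values exchange
    their roles. It lets [chordP] treat one side of the contact interval only. *)
Lemma chordN p s d : p != 0 -> chord p (- s) (- d) = chord p s d.
Proof.
move=> p0; rewrite /chord slopeN /slope fpartN.
by case: eqVneq => [->|_]; rewrite ?powR0 //; ring.
Qed.

(** Split (t + q)^p as t (t + q)^(p-1) + q (t + q)^(p-1); the common factor is at least t^(p-1) and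
    at least 1. This stands in for convexity of the power. *)
Lemma powRD_ge p t q : 1 <= p -> 0 <= t -> 1 <= q -> t `^ p + q <= (t + q) `^ p.
Proof.
move=> p1 t0 q1.
have p0 : 0 < p by lra.
have tq0 : 0 <= t + q by lra.
rewrite -(mulr_powRB1 tq0 p0) -(mulr_powRB1 t0 p0) mulrDl lerD //.
  by rewrite ler_wpM2l // ge0_ler_powR ?nnegrE //; lra.
rewrite ler_peMr //; first lra.
have {1}<- : 1 `^ (p - 1) = 1 :> R by rewrite powR1.
by rewrite ge0_ler_powR ?nnegrE //; lra.
Qed.

Lemma chordE p s (m : int) :
  chord p s (fpart s - m%:~R) = fpart s `^ p + m%:~R * slope p s.
Proof. by rewrite /chord; ring. Qed.

(** For non-integral [s] the power of [1 - fpart s] is positive and that of [fpart s] is at most 1.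
    The strictness here is the source of the strict inequality in [chord_lt]. *)
Lemma slope_gtN1 p s : 0 < p -> -1 < slope p s.
Proof.
move=> p0; rewrite /slope fpartN; have /andP[f0 f1] := fpart_itv s.
case: eqVneq => [->|fn0]; first by rewrite powR0 ?lt0r_neq0 ?subrr //; lra.
have : 0 < (1 - fpart s) `^ p by rewrite powR_gt0 //; lra.
have : fpart s `^ p <= 1.
  have <- : 1 `^ p = 1 :> R by rewrite powR1.
  by rewrite ge0_ler_powR ?nnegrE //; lra.
lra.
Qed.

(** Put q = - m. For q >= 1 the chord is below (fpart s)^p + q by [slope_gtN1], hence below d^p by
    [powRD_ge]; q = 0 is the contact value [fpart s]. *)
Lemma chord_nonpos p s (m : int) : 1 <= p -> m <= 0 ->
  let d := fpart s - m%:~R in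
  if `|d| < 1 then chord p s d = `|d| `^ p else chord p s d < `|d| `^ p.
Proof.
move=> p1 m0 d; have /andP[f0 f1] := fpart_itv s.
rewrite /d chordE; case: (ltrP 0 (- m)) => [mlt|mge].
- have q1 : 1 <= - m%:~R :> R.
    by rewrite -rmorphN /= -[1]/(1%:~R) ler_int; lia.
  rewrite ger0_norm; last lra.
  rewrite ltNge (_ : 1 <= _) /=; last lra.
  apply: lt_le_trans (powRD_ge p1 f0 q1).
  have := slope_gtN1 s (lt_le_trans ltr01 p1).
  move: (slope p s) => c c1.
  rewrite ltrD2l -subr_gt0.
  have -> : - m%:~R - m%:~R * c = (- m%:~R) * (1 + c) by ring.
  by apply: mulr_gt0; lra.
- have -> : m = 0 by lia.
  by rewrite subr0 ger0_norm // f1 mul0r addr0.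
Qed.

Lemma chordP p s d : 1 <= p -> s - d \is a Num.int ->
  if `|d| < 1 then chord p s d = `|d| `^ p else chord p s d < `|d| `^ p.
Proof.
move=> p1 /intrP[k sdk].
have p0 : p != 0 by apply: lt0r_neq0; lra.
pose m := k - Num.floor s.
have dE : d = fpart s - m%:~R by rewrite /m rmorphB /= -sdk /fpart; ring.
have [m0|m0] := lerP m 0; first by have := chord_nonpos s p1 m0; rewrite -dE.
rewrite -(chordN _ _ p0) -(normrN d).
(* As [fpart (- s)] is [1 - fpart s], or 0 at an integer, a carry of 1 appears exactly when
   [fpart s != 0]; [m >= 1] then gives [m' <= 0]. *)
pose m' : int := (fpart s != 0)%:Z - m.
have m'0 : m' <= 0 by rewrite /m'; case: (fpart s != 0); lia.
have -> : - d = fpart (- s) - m'%:~R.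
  by rewrite dE fpartN /m' [in RHS]rmorphB; case: eqVneq => [->|_] /=; ring.
exact: chord_nonpos.
Qed.

Lemma chord_le p s d : 1 <= p -> s - d \is a Num.int -> chord p s d <= `|d| `^ p.
Proof. by move=> p1 /(chordP p1); case: ifP => _ => [->|/ltW]. Qed.

Lemma chord_eq p s d : 1 <= p -> s - d \is a Num.int -> `|d| < 1 ->
  chord p s d = `|d| `^ p.
Proof. by move=> p1 /(chordP p1) + d1; rewrite d1. Qed.

Lemma chord_lt p s d : 1 <= p -> s - d \is a Num.int -> 1 <= `|d| ->
  chord p s d < `|d| `^ p.
Proof. by move=> p1 /(chordP p1) + d1; rewrite ltNge d1. Qed.

End Chord.

(** * The potential u *)

Section Potential.
Variables (R : realType) (n : nat).
Let T := n.+1.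
Implicit Types (X : 'I_T -> R) (x y : R).

Lemma divT_floorDz x y (k : int) :
  Num.floor ((x + k%:~R * T%:R - y) / T%:R) = Num.floor ((x - y) / T%:R) + k.
Proof.
rewrite (_ : (x + _ - y) / _ = (x - y) / T%:R + k%:~R); last first.
  by rewrite addrAC mulrDl mulfK // pnatr_eq0.
by rewrite floorDrz ?intr_int // intrKfloor.
Qed.

Lemma u_periodic X x (k : int) : u X (x + k%:~R * T%:R) = u X x.
Proof.
rewrite /u.
under eq_bigr do rewrite divT_floorDz intrD addrAC.
rewrite big_split /= sumr_const card_ord -mulr_natr; ring.
Qed.

Lemma floor_divT_le x y z : x <= y ->
  Num.floor ((x - z) / T%:R) <= Num.floor ((y - z) / T%:R).
Proof.
by move=> xy; rewrite le_floor // ler_pM2r ?invr_gt0 ?ltr0Sn // lerD2r.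
Qed.

(** The counting sum is nondecreasing, so [u] can grow only through its term [x]. *)
Lemma u_slope_le X x y : x <= y -> u X y <= u X x + (y - x).
Proof.
move=> xy; rewrite /u.
suff : \sum_(i < T) ((Num.floor ((x - X i) / T%:R))%:~R + 1) <=
       \sum_(i < T) ((Num.floor ((y - X i) / T%:R))%:~R + 1) :> R by lra.
by apply: ler_sum => i _; rewrite lerD2r ler_int floor_divT_le.
Qed.

Lemma u_int X x y : x - y - (u X x - u X y) \is a Num.int.
Proof.
pose N z : R := \sum_(i < T) ((Num.floor ((z - X i) / T%:R))%:~R + 1).
rewrite (_ : x - y - _ = N x - N y); last by rewrite /u -/(N x) -/(N y); ring.
by rewrite rpredB // rpred_sum // => i _; rewrite rpredD ?intr_int ?rpred1.
Qed.

(** For each [i] with [X i = x] the floor is 0 at [x] and negative at [x - e], so the counting sum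
    loses at least 1. The error [e] replaces a passage to the left limit. *)
Lemma u_left_jump X x e : 0 < e ->
  u X x + \sum_(i < T) (X i == x)%:R - e <= u X (x - e).
Proof.
move=> e0; rewrite /u.
have : \sum_(i < T) ((Num.floor ((x - e - X i) / T%:R))%:~R + 1 + (X i == x)%:R)
    <= \sum_(i < T) ((Num.floor ((x - X i) / T%:R))%:~R + 1) :> R.
  apply: ler_sum => i _; rewrite addrAC lerD2r.
  case: eqVneq => [->|_]; last by rewrite addr0 ler_int floor_divT_le; lra.
  rewrite subrr mul0r floor0 -[1%:R]/(1%:~R) -intrD ler_int.
  by rewrite lezD1 floor_lt0 pmulr_llt0 ?invr_gt0 ?ltr0Sn //; lra.
rewrite big_split /=.
move: (\sum_(i < T) _) (\sum_(i < T) _) (\sum_(i < T) _) => a b c.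
lra.
Qed.

(** Replacing each floor by its argument minus a fractional part cancels the linear growth, since
    the [T] terms [x / T] add up to [x]. A constant and [T] terms in [-1, 0[ remain. *)
Lemma u_bounded X : exists C, forall x, `|u X x| <= C.
Proof.
pose s := \sum_(i < T) (X i / T%:R).
have T0 : T%:R != 0 :> R by rewrite pnatr_eq0.
exists (`|s| + T%:R) => x.
pose r i : R := fpart ((x - X i) / T%:R).
have uE : u X x = s + \sum_(i < T) (r i - 1).
  have -> : s + \sum_(i < T) (r i - 1) = x + \sum_(i < T)
      (X i / T%:R - x / T%:R + r i - 1).
    under [in RHS]eq_bigr do rewrite addrAC -2!addrA [- _ + _]addrC addrA -addrA.
    rewrite !big_split /= !sumr_const card_ord -/s.
    by rewrite -[- (x / _) *+ _]mulr_natr mulNr mulfVK //; ring.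
  rewrite /u -sumrN; congr (_ + _); apply: eq_bigr => i _.
  by rewrite /r /fpart mulrBl; ring.
rewrite uE (le_trans (ler_normD _ _)) // lerD2l.
apply: (le_trans (ler_norm_sum _ _ _)).
rewrite -[leRHS](_ : \sum_(i < T) 1 = T%:R); last by rewrite sumr_const card_ord.
apply: ler_sum => i _; rewrite /r.
by have := fpart_itv ((x - X i) / T%:R); rewrite ler_norml; lra.
Qed.

(** The function is 1-periodic, so it suffices to compute it on [c, c + 1[. *)
Lemma u_progression X (c : R) : (forall i : 'I_T, X i = c + i%:R) ->
  forall x, u X x = c - 1 + fpart (x - c).
Proof.
move=> XE.
have u1 x : u X (x + 1) = u X x.
  (* A unit shift of [x] lowers each index by one; the first point wraps around to the last with one
     more period, and this extra 1 offsets the growth of [x]. *)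
  rewrite /u big_ord_recl big_ord_recr /=.
  rewrite (_ : (x + 1 - X ord0) / T%:R = (x - X ord_max) / T%:R + 1); last first.
    by rewrite !XE /= -natr1; field; rewrite natr1 pnatr_eq0.
  rewrite floorDrz ?rpred1 // floor1 intrD.
  rewrite (eq_bigr (fun i : 'I_n => (Num.floor
      ((x - X (widen_ord (leqnSn n) i)) / T%:R))%:~R + 1)); first by ring.
  move=> i _; congr (_%:~R + 1); congr (Num.floor (_ / _)).
  by rewrite !XE /= /bump /= natrD; ring.
have unat (m : nat) x : u X (x + m%:R) = u X x.
  elim: m => [|m IH]; first by rewrite addr0.
  by rewrite -natr1 addrA u1.
have uz (k : int) x : u X (x + k%:~R) = u X x.
  case: k => m; first exact: unat.
  by rewrite NegzE rmorphN /= -(unat m.+1 (x - _)) subrK.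
move=> x; pose r := fpart (x - c).
have /andP[r0 r1] : 0 <= r < 1 := fpart_itv _.
have -> : x = c + r + (Num.floor (x - c))%:~R by rewrite /r /fpart; ring.
rewrite uz (_ : c + r + _ - c = r + (Num.floor (x - c))%:~R); last by ring.
rewrite fpartDz [fpart r]/fpart (_ : Num.floor r = 0); last first.
  by apply: floor_def; rewrite add0r r0.
(* On [c, c + 1[ only the first point is counted: its floor is 0, while every other floor is -1 and
   cancels its summand 1. *)
rewrite /u big_ord_recl big1.
  rewrite XE /= (_ : Num.floor _ = 0); first by rewrite mulr0z; ring.
  apply: floor_def; rewrite add0r divr_ge0 ?ler0n //=; last by lra.
  rewrite ltr_pdivrMr ?ltr0Sn // mul1r (@lt_le_trans _ _ 1) ?ler1n //; lra.
move=> i _; rewrite XE (_ : Num.floor _ = -1) ?rmorphN ?addNr //.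
have i1 : 1 <= (lift ord0 i)%:R :> R by rewrite ler1n.
have iT : (lift ord0 i)%:R <= T%:R :> R by rewrite ler_nat ltnW.
apply: floor_def; rewrite addNr rmorphN /= ler_pdivlMr ?ltr0Sn //.
rewrite pmulr_llt0 ?invr_gt0 ?ltr0Sn // mulN1r.
by apply/andP; split; lra.
Qed.

Lemma u_progression_osc X (c : R) : (forall i : 'I_T, X i = c + i%:R) ->
  forall x y, `|u X x - u X y| < 1.
Proof.
move=> XE x y; rewrite !(u_progression XE) ltr_norml.
by have := fpart_itv (x - c); have := fpart_itv (y - c); lra.
Qed.

(** Sorted distinct points at integer distances have successive gaps of at least 1, while a spread
    that is an integer below [T] is at most [n]. Each point is squeezed between the bounds from the
    first and the last one. *)
Lemma config_progression X : is_config X -> injective X ->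
  (forall i j, X i - X j \is a Num.int) -> forall i : 'I_T, X i = X ord0 + i%:R.
Proof.
move=> [Xitv Xle] Xinj Xint.
have gap (i j : 'I_T) : (i <= j)%N -> X i + (j - i)%N%:R <= X j.
  move=> ij; have [m jE] : exists m, (j = i + m :> nat)%N by exists (j - i)%N; lia.
  rewrite jE addKn; elim: m j jE {ij} => [|m IH] j jE.
    by rewrite addr0 Xle // jE leq_addr.
  have jT : (i + m < T)%N by have := ltn_ord j; lia.
  have := IH (Ordinal jT) erefl; set k := Ordinal jT => Xk.
  suff : X k + 1 <= X j by rewrite -natr1; lra.
  have kj : (k <= j)%N by rewrite jE /=; lia.
  have /intrP[z zE] := Xint j k.
  have : 0 < z%:~R :> R.
    rewrite -zE subr_gt0 lt_def Xle // andbT; apply/eqP => /Xinj /(congr1 val) /=.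
    by rewrite jE; lia.
  rewrite ltr0z => z0.
  suff : 1 <= z%:~R :> R by rewrite -zE; lra.
  by rewrite ler1z; lia.
move=> i; have := gap ord0 i (leq0n i); have := gap i ord_max (leq_ord i).
have : X ord_max <= X ord0 + n%:R.
  have /intrP[z zE] := Xint ord_max ord0.
  suff : z%:~R <= n%:R :> R by rewrite -zE; lra.
  have : z%:~R < T%:R :> R.
    by rewrite -zE; have := Xitv ord_max; have := Xitv ord0; lra.
  by rewrite -[T%:R]/(T%:~R) -[n%:R]/(n%:~R) ltr_int ler_int; lia.
rewrite /= subn0 natrB ?leq_ord //.
by move=> *; apply/eqP; rewrite eq_le; apply/andP; split; lra.
Qed.

(* [u] jumps down by at least 1 at [X i], so with oscillation at most 1 it is minimal
   there; equal values of [u] at two points put them at an integer distance, and a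
   double point would be a jump by 2. *)
Lemma osc_le1_progression X : is_config X ->
  (forall x y, `|u X x - u X y| <= 1) -> forall i : 'I_T, X i = X ord0 + i%:R.
Proof.
move=> Xc osc.
have umin i y : u X (X i) <= u X y.
  rewrite leNgt; apply/negP => uy.
  (* After a step to the left by half the excess, [u] is above [u X y] by at least 1 plus the other
     half. *)
  have e0 : 0 < (u X (X i) - u X y) / 2 by lra.
  have := u_left_jump X (X i) e0; rewrite (bigD1 i) //= eqxx mulr1n.
  have := osc (X i - (u X (X i) - u X y) / 2) y; rewrite ler_norml.
  have : 0 <= \sum_(j < T | j != i) (X j == X i)%:R :> R by apply: sumr_ge0.
  lra.
apply: config_progression => // [i j Xij|i j].
  apply/eqP; apply/negPn/negP => ij.
  (* A double point makes [u] larger by at least 2 - 1/2 > 1 at distance 1/2 to its left. *)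
  have e0 : 0 < 2^-1 :> R by lra.
  have := u_left_jump X (X i) e0.
  rewrite (bigD1 i) //= eqxx (bigD1 j) 1?eq_sym //= Xij eqxx !mulr1n.
  have := osc (X j - 2^-1) (X j); rewrite ler_norml.
  have : 0 <= \sum_(k < T | (k != i) && (k != j)) (X k == X j)%:R :> R.
    exact: sumr_ge0.
  lra.
have := u_int X (X i) (X j).
rewrite (_ : u X (X i) = u X (X j)) ?subrr ?subr0 //.
by apply/eqP; rewrite eq_le !umin.
Qed.

End Potential.

(** * Integrals of periodic functions *)

Section Integral.
Variable (R : realType).
Notation mR := (measurableTypeR R).
Notation mu := (@lebesgue_measure R).
Implicit Types (a r : R) (f : R -> R) (A : set R).
Local Open Scope classical_set_scope.

(** By uniqueness of Lebesgue measure, the pushforward need only be compared on half-open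
    intervals. *)
Lemma lebesgue_measure_shift a A : measurable A ->
  mu ((fun x => x + a) @^-1` A) = mu A.
Proof.
have mphi : measurable_fun [set: R] (fun x : R => x + a).
  by apply: measurable_funD.
move=> mA; symmetry.
pose nu : {measure set mR -> \bar R} :=
  @pushforward _ _ mR mR R mu (fun x : R => x + a).
suff munu X : ocitv X -> mu X = nu mphi X
  by exact: (lebesgue_measure_unique munu mA).
move=> [[b c] _ <-] /=; rewrite /nu /= /pushforward.
rewrite [X in _ = lebesgue_measure X](_ : _ = `]b - a, c - a]); last first.
  by apply/seteqP; split => x /=; rewrite !in_itv /= ltrBlDr lerBrDr.
by rewrite !lebesgue_measure_itv /= !lte_fin ltrD2r -!EFinD; case: ifP => // _;
  congr EFin; ring.
Qed.

Lemma lebesgue_measure_reflect a A : measurable A ->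
  mu ((fun x => a - x) @^-1` A) = mu A.
Proof.
have mphi : measurable_fun [set: R] (fun x : R => a - x).
  by apply: measurable_funB.
move=> mA; symmetry.
pose nu : {measure set mR -> \bar R} :=
  @pushforward _ _ mR mR R mu (fun x : R => a - x).
suff munu X : ocitv X -> mu X = nu mphi X
  by exact: (lebesgue_measure_unique munu mA).
move=> [[b c] _ <-] /=; rewrite /nu /= /pushforward.
rewrite [X in _ = lebesgue_measure X](_ : _ = `[a - c, a - b[); last first.
  by apply/seteqP; split => x /=; rewrite !in_itv /= => /andP[? ?];
    apply/andP; split; lra.
rewrite !lebesgue_measure_itv /= !lte_fin ltrD2l ltrN2 -!EFinD.
by case: ifP => // _; congr EFin; ring.
Qed.

(** Nonnegative functions are handled by the pushforward formula, signed ones through their positive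
    and negative parts. *)
Lemma integral_measure_preserving (phi : mR -> mR) (A : set mR)
    (f : mR -> \bar R) :
  measurable_fun setT phi -> (forall B, measurable B -> mu (phi @^-1` B) = mu B) ->
  measurable A -> measurable_fun setT f ->
  (\int[mu]_(x in phi @^-1` A) f (phi x) = \int[mu]_(x in A) f x)%E.
Proof.
move=> mphi phimu mA mf.
have ge0 (g : mR -> \bar R) : measurable_fun setT g -> (forall x, 0 <= g x)%E ->
    (\int[mu]_(x in phi @^-1` A) g (phi x) = \int[mu]_(x in A) g x)%E.
  move=> mg g0; have gA : measurable_fun A g by exact: measurable_funTS.
  have := ge0_integral_pushforward mphi mu mA gA (fun y _ => g0 y).
  by move=> /= <-; apply: eq_measure_integral => B mB _; exact: phimu.
rewrite integralE [RHS]integralE.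
rewrite -(ge0 (f^\+)%E) //; last exact: measurable_funepos.
rewrite -(ge0 (f^\-)%E) //; last exact: measurable_funeneg.
by rewrite funepos_comp funeneg_comp.
Qed.

Lemma integral_shift a (A : set mR) (f : mR -> \bar R) : measurable A ->
  measurable_fun setT f ->
  (\int[mu]_(x in (fun x : R => x + a)%R @^-1` A) f (x + a)%R =
   \int[mu]_(x in A) f x)%E.
Proof.
move=> mA mf; apply: (@integral_measure_preserving (fun x => x + a)%R) => //.
- exact: measurable_funD.
- exact: lebesgue_measure_shift.
Qed.

Lemma preimage_shift_itv a b c :
  (fun x : R => x + a) @^-1` `[b, c[ = `[b - a, c - a[.
Proof.
by apply/seteqP; split => x /=; rewrite !in_itv /= lerBlDr ltrBrDr.
Qed.

(** Reduce [a] modulo [t] to [0, t[, then cut [a, t + a[ at [t] and move the right piece back by one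
    period to [0, a[. *)
Lemma integral_periodic a t (f : mR -> \bar R) : 0 < t ->
  measurable_fun setT f -> (forall (k : int) x, f (x + k%:~R * t) = f x) ->
  (\int[mu]_(x in `[0%R, t]) f (x + a)%R = \int[mu]_(x in `[0%R, t]) f x)%E.
Proof.
move=> t0 mf fper.
have mfS (A : set mR) : measurable_fun A f by apply: measurable_funTS.
have mfa (b : R) : measurable_fun [set: mR] (fun x : R => f (x + b)).
  by apply: (measurableT_comp mf); exact: measurable_funD.
wlog /andP[a0 ta] : a / 0 <= a < t => [wlg|].
  pose k := Num.floor (a / t).
  have := wlg (a - k%:~R * t).
  have /andP[ka kb] := floor_itv (a / t).
  have ka' : k%:~R * t <= a by rewrite -ler_pdivlMr.
  have kb' : a < k%:~R * t + t.
    by rewrite -[X in _ + X]mul1r -mulrDl -ltr_pdivrMr // -[1]/(1%:~R) -intrD.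
  move=> <-; last by apply/andP; split; lra.
  apply: eq_integral => x _.
  by rewrite -(fper k (x + (a - _))); congr f; ring.
(* Dropping the null right endpoint makes the pieces below disjoint. *)
rewrite -!integral_itv_bndo_bndc; [|exact: mfS|exact: measurable_funTS (mfa a)].
transitivity (\int[mu]_(x in `[a, (t + a)%R[) f x)%E.
  by rewrite -[RHS](integral_shift a) // preimage_shift_itv subrr addrK.
have disj b : [disjoint `[b, a[ & `[a, t[].
  apply/disj_setPS => x [] /=; rewrite !in_itv /= => /andP[_ xa] /andP[ax _]; lra.
have -> : (`[a, (t + a)%R[ : set R) = `[a, t[ `|` `[t, (t + a)%R[.
  apply/seteqP; split => x /=; rewrite !in_itv /=.
    by move=> /andP[? ?]; case: (ltrP x t); [left|right]; apply/andP; split; lra.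
  by case=> /andP[? ?]; apply/andP; split; lra.
have -> : (`[0%R, t[ : set R) = `[0%R, a[ `|` `[a, t[.
  apply/seteqP; split => x /=; rewrite !in_itv /=.
    by move=> /andP[? ?]; case: (ltrP x a); [left|right]; apply/andP; split; lra.
  by case=> /andP[? ?]; apply/andP; split; lra.
rewrite !integral_setU //; last first.
  by apply/disj_setPS => x [] /=; rewrite !in_itv /= => /andP[_ xa] /andP[ax _]; lra.
rewrite addeC; congr (_ + _)%E.
rewrite -[LHS](integral_shift t) // preimage_shift_itv subrr [t + a]addrC addrK.
by apply: eq_integral => x _; rewrite -[in RHS](fper 1%Z) mul1r.
Qed.

(** * Vanishing mean of the slope *)

Lemma measurable_fpart : measurable_fun setT (@fpart R).
Proof.
apply: measurable_funB => //; apply: nondecreasing_measurable => // x y xy.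
by rewrite ler_int le_floor.
Qed.

Lemma measurable_slope p : measurable_fun setT (@slope R p).
Proof.
apply: measurable_funB.
  apply: (measurableT_comp (measurable_powR p)).
  by apply: (measurableT_comp measurable_fpart); exact: measurable_funN.
exact: (measurableT_comp (measurable_powR p) measurable_fpart).
Qed.

Lemma slope_le1 (p s : R) : 0 < p -> `|slope p s| <= 1.
Proof.
move=> p0; have := slope_gtN1 s p0; have := slope_gtN1 (- s) p0.
by rewrite slopeN ler_norml; lra.
Qed.

(** Periodicity absorbs the shift by [x]; the reflection of [0, t] onto itself and oddness then
    equate the integral with its opposite. *)
Lemma integral_slope (p x : R) (n : nat) : 0 < p ->
  (\int[mu]_(y in `[0%R, n.+1%:R]) (slope p (y - x))%:E = 0)%E.
Proof.
move=> p0; set t := n.+1%:R.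
have t0 : 0 < t :> R by rewrite ltr0Sn.
pose f (y : mR) := (slope p y)%:E.
have mf : measurable_fun setT f by apply/measurable_EFinP; exact: measurable_slope.
have fper (k : int) y : f (y + k%:~R * t) = f y.
  by rewrite /f /t -[n.+1%:R]/(n.+1%:~R) -intrM slopeDz.
rewrite (integral_periodic (- x) t0 mf fper).
set I := LHS.
have fint : mu.-integrable `[0%R, t] f.
  apply: measurable_bounded_integrable => //.
  - by rewrite /= lebesgue_measure_itv /= lte_fin t0 -EFinB ltry.
  - exact: measurable_funTS (measurable_slope p).
  - exists 1; split => // M M1 y _ /=.
    by apply: le_trans (slope_le1 y p0) _; lra.
have If : I \is a fin_num by exact: integrable_fin_num.
have : I = (- I)%E.
  rewrite {2}/I -integralN.
  - rewrite -(@integral_measure_preserving (fun y => t - y)%R) //.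
    + rewrite (_ : _ @^-1` _ = `[0%R, t]); last first.
        by apply/seteqP; split => y /=; rewrite !in_itv /= => /andP[? ?];
          apply/andP; split; lra.
      apply: eq_integral => y _; rewrite -(fper (-1) (t - y)) /f -EFinN -slopeN.
      by congr (slope p _)%:E; rewrite rmorphN /=; ring.
    + exact: measurable_funB.
    + exact: lebesgue_measure_reflect.
    + exact: measurableT_comp.
  - exact: integrable_add_def.
rewrite -(fineK If) -EFinN => -[II]; congr EFin; lra.
Qed.

End Integral.

(** * The energy *)

Section Energy.
Variables (R : realType) (n : nat) (p : R).
Hypothesis p1 : 1 <= p.
Let p0 : 0 < p := lt_le_trans ltr01 p1.
Notation T := n.+1.
Notation mR := (measurableTypeR R).
Notation mu := (@lebesgue_measure R).
Local Open Scope classical_set_scope.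

Let D : set mR := `[0, T%:R].
Let mD : measurable D. Proof. exact: measurable_itv. Qed.
Let muD : (mu D < +oo)%E.
Proof. by rewrite lebesgue_measure_itv /= lte_fin ltr0Sn -EFinB ltry. Qed.

(** Restricting the measure instead of the domain puts every integral on the whole plane under a
    finite product measure, where bounded measurable functions are integrable and Fubini applies. *)
Let nu : {finite_measure set mR -> \bar R} := mfrestr mD muD.
Let P := (nu \x nu)%E.

Let integral_nu (f : mR -> \bar R) : measurable_fun setT f ->
  (\int[nu]_x f x = \int[mu]_(x in D) f x)%E.
Proof.
move=> mf; rewrite -[in LHS](setUv D) integral_setU //.
- rewrite [X in (_ + X)%E](null_set_integral (N := ~` D)) ?adde0 //.
  + by apply: eq_measure_integral => A mA AD /=; rewrite /mfrestr /mrestr setIidl.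
  + exact: measurableC.
  + exact: measurable_funTS.
  + by rewrite /nu /= /mfrestr /mrestr setICl measure0.
- exact: measurableC.
- exact: measurable_funTS.
- by apply/disj_setPS; rewrite setICr.
Qed.

Lemma measurable_u (X : 'I_T -> R) : measurable_fun [set: mR] (u X).
Proof.
apply: measurable_funB => //; apply: measurable_sum => i.
apply: measurable_funD => //; apply: nondecreasing_measurable => // x y xy.
by rewrite ler_int floor_divT_le.
Qed.

Let integrableP_bounded (f : mR * mR -> R) (C : R) : measurable_fun setT f ->
  (forall z, `|f z| <= C) -> P.-integrable setT (EFin \o f).
Proof.
move=> mf fC; apply: measurable_bounded_integrable => //.
  rewrite /= -setXTT product_measure1E // lte_mul_pinfty ?fin_num_measure //.
  by rewrite -ge0_fin_numE // fin_num_measure.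
exists C; split => [|M CM z _ /=]; first exact: num_real.
exact: le_trans (fC z) (ltW CM).
Qed.

Let measurable_slope2 : measurable_fun setT (fun z : mR * mR => slope p (z.1 - z.2)).
Proof.
by apply: (measurableT_comp (measurable_slope p)); exact: measurable_funB.
Qed.

Let integral_nu_slope (x : R) : (\int[nu]_y (slope p (y - x))%:E = 0)%E.
Proof.
rewrite integral_nu ?integral_slope //; apply/measurable_EFinP.
apply: (measurableT_comp (measurable_slope p)); exact: measurable_funB.
Qed.

Let integrableP_slope1 (v : mR -> R) (C : R) : measurable_fun setT v ->
  (forall x, `|v x| <= C) ->
  P.-integrable setT (fun z => (v z.1 * slope p (z.1 - z.2))%:E).
Proof.
move=> mv vC; apply: (@integrableP_bounded _ C) => [|z]; last first.
  by rewrite normrM -[leRHS]mulr1 ler_pM // slope_le1.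
by apply: measurable_funM => //; exact: measurableT_comp mv _.
Qed.

Let integrableP_slope2 (v : mR -> R) (C : R) : measurable_fun setT v ->
  (forall x, `|v x| <= C) ->
  P.-integrable setT (fun z => (v z.2 * slope p (z.1 - z.2))%:E).
Proof.
move=> mv vC; apply: (@integrableP_bounded _ C) => [|z]; last first.
  by rewrite normrM -[leRHS]mulr1 ler_pM // slope_le1.
by apply: measurable_funM => //; exact: measurableT_comp mv _.
Qed.

Let integralZ_slope (a x : R) : (\int[nu]_y (a * slope p (y - x))%:E = 0)%E.
Proof.
have int_slope : nu.-integrable setT (EFin \o (fun y : mR => slope p (y - x))).
  apply: measurable_bounded_integrable => //.
  - by rewrite -ge0_fin_numE // fin_num_measure.
  - by apply: (measurableT_comp (measurable_slope p)); exact: measurable_funB.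
  - exists 1; split => // M M1 y _ /=.
    by apply: le_trans (slope_le1 _ p0) (ltW M1).
under eq_integral do rewrite EFinM.
by rewrite integralZl // integral_nu_slope mule0.
Qed.

(** Fubini with the variable of [v] outermost: inside, [v] is a constant factor and the slope has
    mean zero. *)
Let integralP_slope2 (v : mR -> R) (C : R) : measurable_fun setT v ->
  (forall x, `|v x| <= C) ->
  (\int[P]_z (v z.2 * slope p (z.1 - z.2))%:E = 0)%E.
Proof.
move=> mv vC; rewrite -integral21_prod_meas1; last exact: integrableP_slope2 mv vC.
by rewrite integral0_eq // => y _; exact: (integralZ_slope (v y) y).
Qed.

Let integralP_slope1 (v : mR -> R) (C : R) : measurable_fun setT v ->
  (forall x, `|v x| <= C) ->
  (\int[P]_z (v z.1 * slope p (z.1 - z.2))%:E = 0)%E.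
Proof.
move=> mv vC; rewrite -integral12_prod_meas1; last exact: integrableP_slope1 mv vC.
rewrite integral0_eq // => x _; rewrite /fubini_F /=.
(* The inner variable is now the subtracted one; oddness turns the slope around, whence the factor
   [- v x]. *)
rewrite -(integralZ_slope (- v x) x); apply: eq_integral => y _ /=.
by rewrite -(opprB y x) slopeN mulrN mulNr.
Qed.

Let chord0_le (s : R) : `|chord p s 0| <= 1 + 1.
Proof.
rewrite /chord subr0 (le_trans (ler_normD _ _)) // normrM.
have /andP[f0 f1] := fpart_itv s.
rewrite lerD //.
  have <- : 1 `^ p = 1 :> R by rewrite powR1.
  by rewrite ger0_norm ?powR_ge0 // ge0_ler_powR ?nnegrE // ltW.
by rewrite -[leRHS]mulr1 ler_pM // ?slope_le1 // ger0_norm // ltW.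
Qed.

Let measurable_fpart2 :
  measurable_fun setT (fun z : mR * mR => fpart (z.1 - z.2)).
Proof.
by apply: (measurableT_comp (@measurable_fpart R)); exact: measurable_funB.
Qed.

Let measurable_chord (d : mR * mR -> R) : measurable_fun setT d ->
  measurable_fun setT (fun z : mR * mR => chord p (z.1 - z.2) (d z)).
Proof.
move=> md; apply: measurable_funD.
  exact: (measurableT_comp (measurable_powR p) measurable_fpart2).
by apply: measurable_funM => //; exact: measurable_funB.
Qed.

(** The affine bound is taken at [d = 0], so no configuration occurs; [integral_chord] identifies
    this value with the integrated bound of every configuration. *)
Definition min_energy : \bar R := (\int[P]_z (chord p (z.1 - z.2) 0)%:E)%E.

(** * Comparison of the energy with the affine bound *)

Section Config.
Variable X : 'I_T -> R.
Let d (z : mR * mR) : R := u X z.1 - u X z.2.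

Let md : measurable_fun setT d.
Proof.
by apply: measurable_funB; apply: (measurableT_comp (measurable_u X)).
Qed.

Let integrable_chord :
  P.-integrable setT (fun z => (chord p (z.1 - z.2) (d z))%:E).
Proof.
have [C uC] := u_bounded X.
apply: (@integrableP_bounded _ (1 + 1 + (C + C))) => [|z].
  exact: measurable_chord.
rewrite (_ : chord _ _ _ = chord p (z.1 - z.2) 0 - d z * slope p (z.1 - z.2)).
  rewrite (le_trans (ler_normB _ _)) // lerD // normrM -[leRHS]mulr1.
  rewrite ler_pM // ?slope_le1 // (le_trans (ler_normB _ _)) //.
  by rewrite lerD ?uC.
by rewrite /chord; ring.
Qed.

(** The chord at [d] differs from the chord at 0 by [d] times the slope; as [d] is a function of [x]
    minus a function of [y], both products integrate to 0. *)
Let integral_chord : (\int[P]_z (chord p (z.1 - z.2) (d z))%:E = min_energy)%E.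
Proof.
have [C uC] := u_bounded X.
have mu := measurable_u X.
have i1 := integrableP_slope1 mu uC; have i2 := integrableP_slope2 mu uC.
have i0 : P.-integrable setT (fun z => (chord p (z.1 - z.2) 0)%:E).
  by apply: (@integrableP_bounded _ (1 + 1)) => // ; exact: measurable_chord.
transitivity (\int[P]_z ((chord p (z.1 - z.2) 0)%:E
   - ((u X z.1 * slope p (z.1 - z.2))%:E - (u X z.2 * slope p (z.1 - z.2))%:E)))%E.
  apply: eq_integral => z _; rewrite -!EFinB; congr EFin.
  by rewrite /chord /d; ring.
rewrite integralB //; last exact: integrableB.
rewrite integralB // (integralP_slope1 mu uC) (integralP_slope2 mu uC).
by rewrite subee // sube0.
Qed.

Let mf : measurable_fun setT (fun z => (`|d z| `^ p)%:E).
Proof.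
apply/measurable_EFinP; apply: (measurableT_comp (measurable_powR p)).
exact: measurableT_comp.
Qed.

Let F0_prod : F0 p X = (\int[P]_z (`|d z| `^ p)%:E)%E.
Proof.
have f0 z : (0 <= (`|d z| `^ p)%:E)%E by rewrite lee_fin powR_ge0.
rewrite fubini_tonelli1 // integral_nu; last first.
  exact: measurable_fun_fubini_tonelli_F.
apply: eq_integral => x _; rewrite /fubini_F integral_nu //.
exact: measurableT_comp mf _.
Qed.

Let integrable_f : P.-integrable setT (fun z => (`|d z| `^ p)%:E).
Proof.
have [C uC] := u_bounded X.
apply: (@integrableP_bounded _ ((C + C) `^ p)) => [|z].
  exact/measurable_EFinP.
have dC : `|d z| <= C + C by rewrite (le_trans (ler_normB _ _)) // lerD ?uC.
rewrite ger0_norm ?powR_ge0 // ge0_ler_powR ?nnegrE ?(ltW p0) //.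
exact: le_trans dC.
Qed.

Lemma F0_ge : (min_energy <= F0 p X)%E.
Proof.
rewrite F0_prod -integral_chord; apply: le_integral => // z _.
by rewrite lee_fin chord_le ?u_int.
Qed.

Lemma F0_eq : (forall x y, `|u X x - u X y| < 1) -> F0 p X = min_energy.
Proof.
move=> osc; rewrite F0_prod -integral_chord; apply: eq_integral => z _.
by rewrite (chord_eq p1 (u_int X z.1 z.2)) ?osc.
Qed.

Let nu_itv (a b : R) : 0 <= a -> a <= b -> b <= T%:R ->
  nu `[a, b] = (b - a)%:E.
Proof.
move=> a0 ab bT; rewrite /nu /= /mfrestr /mrestr setIidl.
  rewrite lebesgue_measure_itv /= lte_fin -EFinB; case: ltrP => // ba.
  by congr EFin; lra.
by move=> x /=; rewrite /D /= !in_itv /= => /andP[? ?]; apply/andP; split; lra.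
Qed.

(* [u] grows at most at unit speed, so a gap larger than 1 persists for [x] slightly
   left of [a] and [y] slightly right of [b], without any continuity of [u]. *)
Let energy_gap_set (a b : R) : 0 < a <= T%:R -> 0 <= b < T%:R ->
  1 < u X a - u X b -> exists2 A : set (mR * mR),
    measurable A /\ (0 < P A)%E & forall z, A z -> 1 <= `|d z|.
Proof.
move=> /andP[a0 aT] /andP[b0 bT] uab.
(* The two sides lose at most [e] each, so half the excess over 1 is affordable; the other bounds
   keep the rectangle inside the square. *)
pose e := Num.min ((u X a - u X b - 1) / 2) (Num.min a (T%:R - b)).
have e0 : 0 < e by rewrite !lt_min; apply/and3P; split; lra.
have /and3P[eu ea eb] : [&& e <= (u X a - u X b - 1) / 2, e <= a & e <= T%:R - b].
  by rewrite /e !ge_min !lexx !orbT.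
exists (`[a - e, a] `*` `[b, b + e]).
  split; first exact: measurableX.
  have -> : (P (`[(a - e)%R, a] `*` `[b, (b + e)%R]) =
      (a - (a - e))%:E * (b + e - b)%:E)%E.
    by rewrite /P product_measure1E //; congr (_ * _)%E; apply: nu_itv; lra.
  by rewrite -EFinM lte_fin; apply: mulr_gt0; lra.
move=> [x y] [/=]; rewrite !in_itv /= => /andP[ax xa] /andP[yb by_].
have := u_slope_le X xa; have := u_slope_le X yb => uy ux.
by apply: le_trans (ler_norm _); rewrite /d /=; lra.
Qed.

(** Equality would force the nonnegative gap between integrand and chord to vanish almost
    everywhere, but it is positive on a rectangle of positive measure. *)
Lemma F0_neq (a b : R) : 1 < u X a - u X b -> F0 p X <> min_energy.
Proof.
(* Representatives modulo [T]: [a'] in ]0, T] leaves room on its left, [b'] in [0, T[ on its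
   right. *)
pose a' := T%:R * (1 - fpart (- (a / T%:R))); pose b' := T%:R * fpart (b / T%:R).
have T0 : 0 < T%:R :> R by rewrite ltr0Sn.
have -> : u X a = u X a'.
  rewrite -(u_periodic X a' (- Num.floor (- (a / T%:R)) - 1)); congr u.
  by rewrite /a' /fpart rmorphB rmorphN /=; field; rewrite gt_eqF.
have -> : u X b = u X b'.
  rewrite -(u_periodic X b' (Num.floor (b / T%:R))); congr u.
  by rewrite /b' /fpart; field; rewrite gt_eqF.
have a'T : 0 < a' <= T%:R.
  have /andP[f0 f1] := fpart_itv (- (a / T%:R)).
  by rewrite /a' pmulr_rgt0 // ger_pMr //; apply/andP; split; lra.
have b'T : 0 <= b' < T%:R.
  have /andP[f0 f1] := fpart_itv (b / T%:R).
  by rewrite /b' pmulr_rge0 // gtr_pMr // f0.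
move=> /(energy_gap_set a'T b'T)[A [mA PA] dA] FJ.
pose g z := ((`|d z| `^ p)%:E - (chord p (z.1 - z.2) (d z))%:E)%E.
have mg : measurable_fun setT g.
  by apply: emeasurable_funB => //; exact: measurable_int integrable_chord.
have : (\int[P]_z `|g z| = 0)%E.
  transitivity (\int[P]_z g z)%E.
    apply: eq_integral => z _; rewrite gee0_abs // /g -EFinB lee_fin subr_ge0.
    by rewrite chord_le ?u_int.
  rewrite integralB // integral_chord -F0_prod FJ subee //.
  by rewrite -integral_chord; exact: integrable_fin_num.
move=> /(ae_eq_integral_abs P measurableT mg)[N [mN PN0 gN]].
have AN : A `<=` N.
  move=> z Az; apply: gN => /(_ I) /eqP.
  rewrite /g -EFinB eqe subr_eq0 gt_eqF // chord_lt ?u_int //.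
  exact: dA.
have : (P A <= P N)%E by rewrite le_measure ?inE.
by rewrite [X in (_ <= X)%E]PN0 leNgt PA.
Qed.

End Config.
End Energy.

(** * Multiplicities *)

Section Multiplicity.
Variables (R : realType).

Lemma is_config_eq_config (T : nat) : is_config (eq_config R T).
Proof.
split=> [i|i j ij]; last by rewrite /eq_config ler_nat.
by rewrite /eq_config ler0n ltr_nat ltn_ord.
Qed.

Lemma mult_progression (T : nat) (X : 'I_T -> R) (c : R) :
  (forall i : 'I_T, X i = c + i%:R) ->
  forall y, mult X y = mult (eq_config R T) (y - c).
Proof.
move=> XE y; apply: eq_bigr => i _; congr nat_of_bool.
by apply: asbool_equiv_eq; rewrite XE /eq_config; split=> -[k yE]; exists k; lra.
Qed.

Lemma mult_gt0 (T : nat) (X : 'I_T -> R) (i : 'I_T) : (0 < mult X (X i))%N.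
Proof.
rewrite /mult (bigD1 i) //= (asboolT (P := exists _, _)) //.
by exists 0; rewrite mul0r addr0.
Qed.

Lemma mult_gt1 (T : nat) (X : 'I_T -> R) (i j : 'I_T) : i != j -> X i = X j ->
  (1 < mult X (X i))%N.
Proof.
move=> ij Xij; rewrite /mult (bigD1 i) //= (bigD1 j) 1?eq_sym //=.
rewrite !(asboolT (P := exists _, _)) //; last by exists 0; rewrite mul0r addr0.
by exists 0; rewrite mul0r addr0.
Qed.

(** Uniqueness of division with remainder by [T]: the index that accounts for [y] is its
    remainder. *)
Lemma mult_eq_config_le1 (T : nat) (y : R) : (mult (eq_config R T) y <= 1)%N.
Proof.
pose b (i : 'I_T) := `[< exists k : int, y = eq_config R T i + k%:~R * T%:R >].
rewrite (_ : mult _ _ = \sum_(i < T) nat_of_bool (b i))%N //.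
have binj i j : b i -> b j -> i = j.
  move=> /asboolP[k yi] /asboolP[l yj]; apply/val_inj => /=.
  move: yj; rewrite yi /eq_config => /eqP.
  rewrite -[i%:R]/(i%:~R) -[j%:R]/(j%:~R) -[T%:R]/(T%:~R) -!intrM -!intrD eqr_int.
  have := ltn_ord i; have := ltn_ord j; move: (nat_of_ord i) (nat_of_ord j).
  move=> a c aT cT /eqP E.
  have : k = l by nia.
  by lia.
case: (pickP b) => [i bi|b0]; last by rewrite big1 // => i _; rewrite b0.
rewrite (bigD1 i) //= big1 ?addn0 ?leq_b1 // => j ji.
by case bj: (b j) => //; move: ji; rewrite (binj j i bj bi) eqxx.
Qed.

Lemma mult_eq_config_int (T : nat) (y : R) :
  (0 < mult (eq_config R T) y)%N -> y \is a Num.int.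
Proof.
rewrite lt0n sum_nat_eq0 negb_forall => /existsP[i].
rewrite implyTb eqb0 negbK => /asboolP[k ->].
by rewrite /eq_config rpredD // ?rpredM ?intr_int ?natr_int.
Qed.

(** Multiplicities at most 1 exclude repeated points, and positive ones occur only at integers, so
    all [X k - a] are integers. The progression starts at [X ord0], which may differ from [a] by an
    integer. *)
Lemma progression_of_mult (n : nat) (X : 'I_n.+1 -> R) (a : R) : is_config X ->
  (forall y, mult X y = mult (eq_config R n.+1) (y - a)) ->
  forall i : 'I_n.+1, X i = X ord0 + i%:R.
Proof.
move=> Xc multX; apply: config_progression => // [i j Xij|i j].
  apply/eqP; apply/negPn/negP => ij.
  by have := mult_gt1 ij Xij; rewrite multX ltnNge mult_eq_config_le1.
have Xa k : X k - a \is a Num.int.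
  by apply: (@mult_eq_config_int n.+1); rewrite -multX mult_gt0.
by have := rpredB (Xa i) (Xa j); rewrite opprB addrA subrK.
Qed.

End Multiplicity.

Theorem mainTheorem13 (R : realType) (p : R) (T : nat) (hp : 1 <= p) :
  is_config (eq_config R T) /\
  (forall Y : 'I_T -> R, is_config Y -> (F0 p (eq_config R T) <= F0 p Y)%E) /\
  (forall X : 'I_T -> R, is_config X ->
     ((forall Y : 'I_T -> R, is_config Y -> (F0 p X <= F0 p Y)%E) <->
      exists a : R, forall y : R, mult X y = mult (eq_config R T) (y - a))).
Proof.
split; first exact: is_config_eq_config.
(* For [T = 0] the empty tuple is the only configuration. *)
case: T => [|n].
  have all_eq (X Y : 'I_0 -> R) : X = Y by apply/funext => -[].
  split=> [Y _|X _]; first by rewrite (all_eq (eq_config R 0) Y).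
  split=> [_|_ Y _]; last by rewrite (all_eq X Y).
  by exists 0 => y; rewrite /mult !big_ord0.
have F0_eq_config : F0 p (eq_config R n.+1) = min_energy n p.
  apply: F0_eq => //; apply: (u_progression_osc (c := 0)) => i.
  by rewrite add0r.
split=> [Y _|X Xc]; first by rewrite F0_eq_config F0_ge.
split=> [Xmin|[a multX] Y _].
- exists (X ord0); apply: mult_progression; apply: osc_le1_progression => // x y.
  have F0X : F0 p X = min_energy n p.
    apply/eqP; rewrite eq_le F0_ge // andbT -F0_eq_config.
    exact: Xmin (is_config_eq_config _ _).
  (* A difference above 1, in either order, would contradict the equality [F0X]. *)
  rewrite ler_norml; apply/andP; split; rewrite leNgt; apply/negP => uxy.
    by apply: (@F0_neq R n p hp X y x) => //; lra.
  exact: (@F0_neq R n p hp X x y).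
- have XE := progression_of_mult Xc multX.
  by rewrite (F0_eq hp (u_progression_osc XE)) F0_ge.
Qed.
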